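(* Let $\lambda\in\mathbb{K}$. (a) Let $(A,A_r^* )$ be a factorizable dendriform D-bialgebra with $I=r_+-r_-$. Then $(A,P,\omega_I)$ (that is, $(A,\prec_A,\succ_A,P,\omega_I)$) is a quadratic Rota-Baxter dendriform algebra of weight $\lambda$, where the linear map $P:A\to A$ and $\omega_I\in\wedge^2A^*$ are defined by $$P=\lambda\, r_-\circ I^{-1},\qquad \omega_I(x,y)=\langle I^{-1}x,y\rangle,\quad\forall x,y\in A.$$ (b) Conversely, suppose $\lambda\neq0$, let $(A,\prec_A,\succ_A,P,\omega)$ be a quadratic Rota-Baxter dendriform algebra of weight $\lambda$, and let $\mathcal{J}_\omega:A^*\to A$ be the induced linear isomorphism given by $\langle\mathcal{J}_\omega^{-1}x,y\rangle=\omega(x,y)$. Then $r\in A\otimes A$ defined by $$r_+:=\tfrac1\lambda(P+\lambda\,\mathrm{Id})\circ\mathcal{J}_\omega:A^*\to A,\qquad r_+(\xi)=r(\xi,\cdot),\quad\forall\xi\in A^*,$$ satisfies the D-equation $r_{12}\ast r_{13}-r_{13}\prec r_{23}-r_{23}\succ r_{12}=0$ and gives rise to a factorizable dendriform D-bialgebra $(A,A_r^* )$.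
   Context: All vector spaces are finite-dimensional over a field $\mathbb{K}$ of characteristic different from $2$. A dendriform algebra $(A,\prec_A,\succ_A)$ is a vector space with two bilinear products such that, with $x\ast y=x\prec_A y+x\succ_A y$, for all $x,y,z$: $(x\prec_A y)\prec_A z=x\prec_A(y\ast z)$, $(x\succ_A y)\prec_A z=x\succ_A(y\prec_A z)$, $x\succ_A(y\succ_A z)=(x\ast y)\succ_A z$. For any dendriform algebra $A$ put $L_{\succ_A}(x)y=x\succ_A y$, $L_{\prec_A}(x)y=x\prec_A y$, $R_{\succ_A}(x)y=y\succ_A x$, $R_{\prec_A}(x)y=y\prec_A x$, $\mathcal{L}_A=L_{\prec_A}+L_{\succ_A}$, $\mathcal{R}_A=R_{\prec_A}+R_{\succ_A}$; for $F:A\to\mathfrak{gl}(A)$ define $F^*:A\to\mathfrak{gl}(A^* )$ by $\langle F^*(x)\xi,y\rangle=\langle\xi,F(x)y\rangle$ (no sign). The same notation is used for a dendriform algebra structure on $A^*$. A Rota-Baxter operator of weight $\lambda$ on $(A,\prec_A,\succ_A)$ is a linear map $P:A\to A$ with $P(x)\prec_A P(y)=P(P(x)\prec_A y+x\prec_A P(y)+\lambda x\prec_A y)$ and $P(x)\succ_A P(y)=P(P(x)\succ_A y+x\succ_A P(y)+\lambda x\succ_A y)$. A quadratic Rota-Baxter dendriform algebra of weight $\lambda$ is a tuple $(A,\prec_A,\succ_A,P,\omega)$ where $P$ is a Rota-Baxter operator of weight $\lambda$ on the dendriform algebra $(A,\prec_A,\succ_A)$ and $\omega\in\wedge^2A^*$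 is a nondegenerate skew-symmetric bilinear form with $\omega(x\succ_A y,z)=-\omega(x,y\prec_A z)=\omega(y,z\ast x)$ and $\omega(Px,y)+\omega(x,Py)+\lambda\omega(x,y)=0$ for all $x,y,z\in A$. For $r=\sum_i a_i\otimes b_i\in A\otimes A$, define $r_+,r_-:A^*\to A$ by $r(\xi,\eta)=\langle r_+(\xi),\eta\rangle=\langle\xi,r_-(\eta)\rangle$, $I=r_+-r_-$; with the flip $\sigma(x\otimes y)=y\otimes x$, the skew-symmetric part of $r$ is $a=\frac12(r-\sigma(r))$. An element $s\in A\otimes A$ is $(L_\succ,R_\prec)$-invariant if $(\mathrm{Id}\otimes\mathcal{L}_A(x)-R_{\prec_A}(x)\otimes\mathrm{Id})s=0$ and $(\mathrm{Id}\otimes L_{\succ_A}(x)-\mathcal{R}_A(x)\otimes\mathrm{Id})\sigma(s)=0$ for all $x\in A$. In the D-equation, $r_{12}\ast r_{13}=\sum_{i,j}(a_i\ast a_j)\otimes b_i\otimes b_j$, $r_{13}\prec r_{23}=\sum_{i,j}a_i\otimes a_j\otimes(b_i\prec_A b_j)$, $r_{23}\succ r_{12}=\sum_{i,j}a_j\otimes(a_i\succ_A b_j)\otimes b_i$. Dendriform D-bialgebra $(A,A^* )$: dendriform algebra structures $(\prec_A,\succ_A)$ on $A$ and $(\prec_{A^*},\succ_{A^*})$ on $A^*$ such that, writing $\Delta_\prec,\Delta_\succ:A\to A\otimes A$ for the linear duals of $\prec_{A^*},\succ_{A^*}$ and $\beta_\prec,\beta_\succ:A^*\to A^*\otimes A^*$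 for the linear duals of $\prec_A,\succ_A$, and $\sigma'$ for the flip on $A^*\otimes A^*$, for all $x,y\in A$, $\xi,\eta\in A^*$: (1) $\Delta_\prec(x\ast y)=(\mathrm{Id}\otimes L_{\succ_A}(x))\Delta_\prec(y)+(\mathcal{R}_A(y)\otimes\mathrm{Id})\Delta_\prec(x)$; (2) $\Delta_\succ(x\ast y)=(\mathrm{Id}\otimes\mathcal{L}_A(x))\Delta_\succ(y)+(R_{\prec_A}(y)\otimes\mathrm{Id})\Delta_\succ(x)$; (3) $\beta_\prec(\xi\prec_{A^*}\eta+\xi\succ_{A^*}\eta)=(\mathrm{Id}\otimes L_{\succ_{A^*}}(\xi))\beta_\prec(\eta)+(\mathcal{R}_{A^*}(\eta)\otimes\mathrm{Id})\beta_\prec(\xi)$; (4) $\beta_\succ(\xi\prec_{A^*}\eta+\xi\succ_{A^*}\eta)=(\mathrm{Id}\otimes\mathcal{L}_{A^*}(\xi))\beta_\succ(\eta)+(R_{\prec_{A^*}}(\eta)\otimes\mathrm{Id})\beta_\succ(\xi)$; (5) $(\mathcal{L}_A(x)\otimes\mathrm{Id}-\mathrm{Id}\otimes R_{\prec_A}(x))\Delta_\prec(y)+\sigma\big((L_{\succ_A}(y)\otimes\mathrm{Id}-\mathrm{Id}\otimes\mathcal{R}_A(y))\Delta_\succ(x)\big)=0$; (6) $(\mathcal{L}_{A^*}(\xi)\otimes\mathrm{Id}-\mathrm{Id}\otimes R_{\prec_{A^*}}(\xi))\beta_\prec(\eta)+\sigma'\big((L_{\succ_{A^*}}(\eta)\otimes\mathrm{Id}-\mathrm{Id}\otimes\mathcal{R}_{A^*}(\eta))\beta_\succ(\xi)\big)=0$.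 $A_r^*$ denotes $A^*$ with the products $$\xi\succ_r\eta=\mathcal{R}_A^*(r_+(\xi))\eta-L_{\prec_A}^*(r_-(\eta))\xi,\qquad \xi\prec_r\eta=\mathcal{L}_A^*(r_+(\eta))\xi-R_{\succ_A}^*(r_-(\xi))\eta.$$ If $r$ satisfies the D-equation and $a$ is $(L_\succ,R_\prec)$-invariant, then $(A,A_r^* )$ is a dendriform D-bialgebra, called quasi-triangular; it is called factorizable if moreover $a$ is nondegenerate, i.e. $I:A^*\to A$ is a linear isomorphism. *)

(* Defs.v *)
From HB Require Import structures.
From mathcomp Require Import all_boot all_order all_algebra.

Set Implicit Arguments.
Unset Strict Implicit.
Unset Printing Implicit Defensive.

Import GRing.Theory.
Local Open Scope ring_scope.

(* The dual space; <xi, x> is written [xi x]. *)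
Notation dual V := 'Hom(V, _^o).

(* MathComp has no tensor product.  [tensor U V] is the concrete model of
   U (x) V whose elements are the matrices of coefficients in the basis
   e_i (x) f_j, where e and f are the bases [vbasis] of U and V.  [tens u v] is
   the pure tensor and [tlift f] is the linear map induced by a bilinear map [f]:
   the universal property is [tens_bilinear], [tliftE] and [tensor_pure_sum]. *)
Section Tensor.
Variable K : fieldType.
Implicit Types U V W : vectType K.

Definition tensor U V := 'M[K]_(\dim {:U}, \dim {:V}).

HB.instance Definition _ U V :=
  Vector.copy (tensor U V) 'M[K]_(\dim {:U}, \dim {:V}).

Definition bvec V (i : 'I_(\dim {:V})) : V := (vbasis {:V})`_i.

Definition bcov V (i : 'I_(\dim {:V})) : dual V :=
  linfun (coord (vbasis {:V}) i : V -> K^o).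

Definition tens U V (u : U) (v : V) : tensor U V :=
  \matrix_(i, j) (bcov i u * bcov j v).

Definition tlift U V W (f : U -> V -> W) (t : tensor U V) : W :=
  \sum_i \sum_j t i j *: f (bvec i) (bvec j).

(* f (x) g *)
Definition tmap U V U' V' (f : U -> U') (g : V -> V') :
    tensor U V -> tensor U' V' :=
  tlift (fun u v => tens (f u) (g v)).

Definition tflip U V : tensor U V -> tensor V U :=
  tlift (fun u v => tens v u).

(* t(xi, eta), i.e. the pairing of t with xi (x) eta *)
Definition teval U V (t : tensor U V) (xi : dual U) (eta : dual V) : K :=
  tlift (fun u v => (xi u * eta v : K^o)) t.

(* r_+ and r_- : see [rplusP] and [rminusP]. *)
Definition rplus V (r : tensor V V) : 'Hom(dual V, V) :=
  linfun (fun xi : dual V => tlift (fun a b => (xi a : K) *: b) r).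

Definition rminus V (r : tensor V V) : 'Hom(dual V, V) :=
  linfun (fun eta : dual V => tlift (fun a b => (eta b : K) *: a) r).

Definition rI V (r : tensor V V) : 'Hom(dual V, V) := rplus r - rminus r.

Definition tskew V (r : tensor V V) : tensor V V := 2%:R^-1 *: (r - tflip r).

(* Linear duals of a product on V* and of a product on V, see [cop_dualP] and
   [copP]. *)
Definition cop_dual V (m : dual V -> dual V -> dual V) (x : V) : tensor V V :=
  \sum_i \sum_j (m (bcov i) (bcov j) x : K) *: tens (bvec i) (bvec j).

Definition cop V (m : V -> V -> V) (xi : dual V) : tensor (dual V) (dual V) :=
  \sum_i \sum_j (xi (m (bvec i) (bvec j)) : K) *: tens (bcov i) (bcov j).

(* [Ftr F xi] is xi \o F, for linear F : V -> V. *)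
Definition Ftr V (F : V -> V) (xi : dual V) : dual V :=
  linfun (fun y => xi (F y)).

Lemma bvec_sum V (v : V) : v = \sum_i (bcov i v : K) *: bvec i.
Proof.
rewrite {1}(coord_vbasis (memvf v)); apply: eq_bigr => i _.
by rewrite lfunE.
Qed.

Lemma bcov_bvec V (i j : 'I_(\dim {:V})) : bcov i (bvec j) = (i == j)%:R.
Proof.
by rewrite lfunE /= coord_free ?(basis_free (vbasisP _)) // eq_sym.
Qed.

Let scaleoE (a : K) (b : K^o) : a *: b = a * b. Proof. by []. Qed.

Let dualZ V (xi : dual V) (a : K) v : xi (a *: v) = a * xi v.
Proof. by rewrite linearZ. Qed.

Lemma bcov_sum V (xi : dual V) : xi = \sum_i (xi (bvec i) : K) *: bcov i.
Proof.
apply/lfunP => v; rewrite sum_lfunE {1}(bvec_sum v) linear_sum.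
apply: eq_bigr => i _.
by rewrite linearZ scale_lfunE /= !scaleoE [LHS]mulrC.
Qed.

Lemma tlift_is_linear U V W (f : U -> V -> W) : linear (tlift f).
Proof.
move=> a s t; rewrite /tlift scaler_sumr -big_split; apply: eq_bigr => i _.
rewrite scaler_sumr -big_split; apply: eq_bigr => j _.
by rewrite !mxE scalerDl scalerA.
Qed.

HB.instance Definition _ U V W (f : U -> V -> W) :=
  GRing.isLinear.Build K (tensor U V) W _ (tlift f) (tlift_is_linear f).

Lemma linear_bvec U W (f : U -> W) (fL : linear f) u :
  f u = \sum_i (bcov i u : K) *: f (bvec i).
Proof.
pose g : {linear U -> W} := HB.pack f (GRing.isLinear.Build K U W _ _ fL).
have gE v : f v = g v by [].
rewrite gE {1}(bvec_sum u) linear_sum; apply: eq_bigr => i _.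
by rewrite linearZ_LR gE.
Qed.

Lemma linear_bcov V W (f : dual V -> W) (fL : linear f) xi :
  f xi = \sum_i (xi (bvec i) : K) *: f (bcov i).
Proof.
pose g : {linear dual V -> W} :=
  HB.pack f (GRing.isLinear.Build K (dual V) W _ _ fL).
have gE v : f v = g v by [].
rewrite gE {1}(bcov_sum xi) linear_sum; apply: eq_bigr => i _.
by rewrite linearZ_LR gE.
Qed.

Lemma bilinear_bvec U V W (f : U -> V -> W) (fB : bilinear_for *:%R *:%R f) u v :
  f u v = \sum_i \sum_j (bcov i u * bcov j v : K) *: f (bvec i) (bvec j).
Proof.
rewrite [LHS](linear_bvec (fB.1 v)); apply: eq_bigr => i _.
rewrite [X in _ *: X](linear_bvec (fB.2 (bvec i))) scaler_sumr.
by apply: eq_bigr => j _; rewrite scalerA.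
Qed.

Lemma tliftE U V W (f : U -> V -> W) (fB : bilinear_for *:%R *:%R f) u v :
  tlift f (tens u v) = f u v.
Proof.
rewrite (bilinear_bvec fB); apply: eq_bigr => i _; apply: eq_bigr => j _.
by rewrite mxE.
Qed.

Lemma tlift_sum U V W (f : U -> V -> W) (fB : bilinear_for *:%R *:%R f)
    (I : finType) (a : I -> U) (b : I -> V) :
  tlift f (\sum_i tens (a i) (b i)) = \sum_i f (a i) (b i).
Proof. by rewrite linear_sum; apply: eq_bigr => i _; exact: tliftE. Qed.

Lemma tens_bilinear U V : bilinear_for *:%R *:%R (@tens U V).
Proof.
split=> w a x y; apply/matrixP => i j; rewrite !mxE linearP /=.
  by rewrite mulrDl -mulrA.
by rewrite mulrDr mulrCA.
Qed.

Lemma tensor_sum U V (t : tensor U V) :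
  t = \sum_i \sum_j t i j *: tens (bvec i) (bvec j).
Proof.
apply/matrixP => i j; rewrite summxE (bigD1 i) //= summxE (bigD1 j) //=.
rewrite !mxE !bcov_bvec !eqxx mul1r mulr1 big1 => [|k /negPf kj].
  rewrite addr0 big1 ?addr0 // => k /negPf ki; rewrite summxE big1 // => l _.
  by rewrite !mxE !bcov_bvec eq_sym ki mul0r mulr0.
by rewrite !mxE !bcov_bvec [j == k]eq_sym kj !mulr0.
Qed.

Lemma tensor_pure_sum U V (t : tensor U V) :
  exists (I : finType) (a : I -> U) (b : I -> V), t = \sum_i tens (a i) (b i).
Proof.
exists ('I_(\dim {:U}) * 'I_(\dim {:V}))%type.
exists (fun ij => t ij.1 ij.2 *: bvec ij.1), (fun ij => bvec ij.2).
rewrite {1}(tensor_sum t) pair_big /=; apply: eq_bigr => -[i j] _ /=.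
by apply/matrixP => k l; rewrite !mxE linearZ /= -mulrA.
Qed.

Lemma linfunE U W (f : U -> W) (fL : linear f) u : linfun f u = f u.
Proof.
exact: (lfunE (HB.pack f (GRing.isLinear.Build K U W _ _ fL) : {linear U -> W})).
Qed.

Let contrL V (r : tensor V V) :
  linear (fun xi : dual V => tlift (fun a b => (xi a : K) *: b) r).
Proof.
move=> a x y; rewrite /tlift scaler_sumr -big_split; apply: eq_bigr => i _.
rewrite scaler_sumr -big_split; apply: eq_bigr => j _.
rewrite add_lfunE scale_lfunE /= scaleoE scalerDl scalerDr !scalerA.
by rewrite mulrCA.
Qed.

Let contrR V (r : tensor V V) :
  linear (fun eta : dual V => tlift (fun a b => (eta b : K) *: a) r).
Proof.
move=> a x y; rewrite /tlift scaler_sumr -big_split; apply: eq_bigr => i _.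
rewrite scaler_sumr -big_split; apply: eq_bigr => j _.
rewrite add_lfunE scale_lfunE /= scaleoE scalerDl scalerDr !scalerA.
by rewrite mulrCA.
Qed.

Lemma rplusE V (r : tensor V V) xi :
  rplus r xi = tlift (fun a b => (xi a : K) *: b) r.
Proof. exact: (linfunE (contrL r)). Qed.

Lemma rminusE V (r : tensor V V) eta :
  rminus r eta = tlift (fun a b => (eta b : K) *: a) r.
Proof. exact: (linfunE (contrR r)). Qed.

Lemma rplusP V (r : tensor V V) (xi eta : dual V) :
  eta (rplus r xi) = teval r xi eta.
Proof.
rewrite rplusE /teval /tlift linear_sum; apply: eq_bigr => i _.
rewrite linear_sum; apply: eq_bigr => j _.
by rewrite /= !dualZ.
Qed.

Lemma rminusP V (r : tensor V V) (xi eta : dual V) :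
  xi (rminus r eta) = teval r xi eta.
Proof.
rewrite rminusE /teval /tlift linear_sum; apply: eq_bigr => i _.
rewrite linear_sum; apply: eq_bigr => j _; rewrite /= !dualZ.
by rewrite scaleoE [xi _ * _]mulrC.
Qed.

Let bilinear_pair U V (xi : dual U) (eta : dual V) :
  bilinear_for *:%R *:%R (fun u v => (xi u * eta v : K^o)).
Proof.
split=> w a x y; rewrite linearP /= !scaleoE.
  by rewrite mulrDl -mulrA.
by rewrite mulrDr mulrCA.
Qed.

Lemma teval_tens U V (u : U) (v : V) xi eta :
  teval (tens u v) xi eta = xi u * eta v.
Proof. exact: (tliftE (bilinear_pair xi eta)). Qed.

Lemma FtrE V (F : V -> V) (xi : dual V) (y : V) :
  linear F -> Ftr F xi y = xi (F y).
Proof.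
by move=> FL; apply: (@linfunE V K^o) => a u v; rewrite FL linearP.
Qed.

Lemma cop_dualP V (m : dual V -> dual V -> dual V) :
    bilinear_for *:%R *:%R m ->
  forall x xi eta, teval (cop_dual m x) xi eta = m xi eta x.
Proof.
move=> mB x xi eta; rewrite [m xi eta](linear_bcov (mB.1 eta)) sum_lfunE.
rewrite /teval linear_sum; apply: eq_bigr => i _.
rewrite [m (bcov i) eta](linear_bcov (mB.2 (bcov i))) scaler_sumr sum_lfunE.
rewrite linear_sum; apply: eq_bigr => j _.
rewrite linearZ_LR /= tliftE; last exact: bilinear_pair.
by rewrite !scale_lfunE !scaleoE mulrC mulrA.
Qed.

Lemma copP V (m : V -> V -> V) : bilinear_for *:%R *:%R m ->
  forall (xi : dual V) (x y : V),
    tlift (fun zeta theta : dual V => (zeta x * theta y : K^o)) (cop m xi)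
    = xi (m x y).
Proof.
move=> mB xi x y; rewrite (bilinear_bvec mB x y) !linear_sum.
apply: eq_bigr => i _; rewrite !linear_sum; apply: eq_bigr => j _.
rewrite /= dualZ linearZ_LR /= tliftE; first by rewrite !scaleoE mulrC.
split=> w a u v; rewrite add_lfunE scale_lfunE /= !scaleoE.
  by rewrite mulrDl -mulrA.
by rewrite mulrDr mulrCA.
Qed.

End Tensor.

Section Dendriform.
Variable K : fieldType.

Section Algebra.
Variable V : vectType K.
Implicit Types (m : V -> V -> V) (prec succ : {bilinear V -> V -> V}).

Definition star prec succ (x y : V) : V := prec x y + succ x y.

Definition Lop m (x : V) : V -> V := fun y => m x y.
Definition Rop m (x : V) : V -> V := fun y => m y x.

Record is_dendriform prec succ : Prop := IsDendriform {
  dend_prec : forall x y z,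
    prec (prec x y) z = prec x (star prec succ y z);
  dend_mid : forall x y z,
    prec (succ x y) z = succ x (prec y z);
  dend_succ : forall x y z,
    succ x (succ y z) = succ (star prec succ x y) z
}.

Definition is_rota_baxter (lambda : K) (m : V -> V -> V) (P : 'End(V)) : Prop :=
  forall x y, m (P x) (P y) = P (m (P x) y + m x (P y) + lambda *: m x y).

Record is_quadratic_RB prec succ (lambda : K) (P : 'End(V))
    (omega : {biscalar V}) : Prop := IsQuadraticRB {
  qRB_dend : is_dendriform prec succ;
  qRB_prec : is_rota_baxter lambda prec P;
  qRB_succ : is_rota_baxter lambda succ P;
  qRB_skew : forall x y, omega x y = - omega y x;
  qRB_nondeg : forall x, (forall y, omega x y = 0) -> x = 0;
  qRB_omega_prec : forall x y z, omega (succ x y) z = - omega x (prec y z);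
  qRB_omega_star : forall x y z,
    omega (succ x y) z = omega y (star prec succ z x);
  qRB_omega_P : forall x y,
    omega (P x) y + omega x (P y) + lambda * omega x y = 0
}.

Definition LR_invariant prec succ (s : tensor V V) : Prop :=
  forall x,
    tmap id (Lop (star prec succ) x) s - tmap (Rop prec x) id s = 0 /\
    tmap id (Lop succ x) (tflip s)
      - tmap (Rop (star prec succ) x) id (tflip s) = 0.

(* V (x) V (x) V is read as V (x) (V (x) V). *)
Definition D_12_13 prec succ (r : tensor V V) : tensor V (tensor V V) :=
  tlift (fun ai bi => tlift (fun aj bj =>
    tens (star prec succ ai aj) (tens bi bj)) r) r.

Definition D_13_23 prec (r : tensor V V) : tensor V (tensor V V) :=
  tlift (fun ai bi => tlift (fun aj bj =>
    tens ai (tens aj (prec bi bj))) r) r.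

Definition D_23_12 succ (r : tensor V V) : tensor V (tensor V V) :=
  tlift (fun ai bi => tlift (fun aj bj =>
    tens aj (tens (succ ai bj) bi)) r) r.

Definition D_equation prec succ (r : tensor V V) : Prop :=
  D_12_13 prec succ r - D_13_23 prec r - D_23_12 succ r = 0.

(* The half of the bialgebra conditions that bears on the coproducts
   Dprec, Dsucc : V -> V (x) V; the other half is its instance at V*. *)
Record D_compatible prec succ (Dprec Dsucc : V -> tensor V V) : Prop :=
    DCompatible {
  Dcomp_prec : forall x y, Dprec (star prec succ x y) =
    tmap id (Lop succ x) (Dprec y)
    + tmap (Rop (star prec succ) y) id (Dprec x);
  Dcomp_succ : forall x y, Dsucc (star prec succ x y) =
    tmap id (Lop (star prec succ) x) (Dsucc y)
    + tmap (Rop prec y) id (Dsucc x);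
  Dcomp_mixed : forall x y,
    (tmap (Lop (star prec succ) x) id (Dprec y)
      - tmap id (Rop prec x) (Dprec y))
    + tflip (tmap (Lop succ y) id (Dsucc x)
      - tmap id (Rop (star prec succ) y) (Dsucc x)) = 0
}.

End Algebra.

Record is_D_bialgebra (A : vectType K) (prec succ : {bilinear A -> A -> A})
    (precd succd : {bilinear dual A -> dual A -> dual A}) : Prop :=
    IsDBialgebra {
  Dbi_dend : is_dendriform prec succ;
  Dbi_dend_dual : is_dendriform precd succd;
  Dbi_comp : D_compatible prec succ (cop_dual precd) (cop_dual succd);
  Dbi_comp_dual : D_compatible precd succd (cop prec) (cop succ)
}.

Section Factorizable.
Variables (A : vectType K) (prec succ : {bilinear A -> A -> A}).
Variable r : tensor A A.

Definition rsucc (xi eta : dual A) : dual A :=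
  Ftr (Rop (star prec succ) (rplus r xi)) eta - Ftr (Lop prec (rminus r eta)) xi.

Definition rprec (xi eta : dual A) : dual A :=
  Ftr (Lop (star prec succ) (rplus r eta)) xi - Ftr (Rop succ (rminus r xi)) eta.

Let starL x : linear (Lop (star prec succ) x).
Proof. by move=> a u v; rewrite /Lop /star !linearPr scalerDr addrACA. Qed.

Let starR x : linear (Rop (star prec succ) x).
Proof. by move=> a u v; rewrite /Rop /star !linearPl scalerDr addrACA. Qed.

Let precL x : linear (Lop prec x).
Proof. by move=> a u v; rewrite /Lop linearPr. Qed.

Let succR x : linear (Rop succ x).
Proof. by move=> a u v; rewrite /Rop linearPl. Qed.

Lemma rsuccE (xi eta : dual A) y : rsucc xi eta y =
  eta (star prec succ y (rplus r xi)) - xi (prec (rminus r eta) y).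
Proof. by rewrite /rsucc !lfunE /= lfunE /= !FtrE. Qed.

Lemma rprecE (xi eta : dual A) y : rprec xi eta y =
  xi (star prec succ (rplus r eta) y) - eta (succ y (rminus r xi)).
Proof. by rewrite /rprec !lfunE /= lfunE /= !FtrE. Qed.

Lemma rsucc_is_bilinear : bilinear_for *:%R *:%R rsucc.
Proof.
split=> z a x y; apply/lfunP => v;
  rewrite [RHS]add_lfunE [X in _ = X + _]scale_lfunE !rsuccE.
  rewrite [rplus r _]linearP [star _ _ _ _]starL [z _]linearP.
  by rewrite add_lfunE scale_lfunE scalerBr opprD addrACA.
rewrite [rminus r _]linearP [prec _ _]linearPl [z _]linearP.
by rewrite add_lfunE scale_lfunE scalerBr opprD addrACA.
Qed.

Lemma rprec_is_bilinear : bilinear_for *:%R *:%R rprec.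
Proof.
split=> z a x y; apply/lfunP => v;
  rewrite [RHS]add_lfunE [X in _ = X + _]scale_lfunE !rprecE.
  rewrite [rminus r _]linearP [succ _ _]linearPr [z _]linearP.
  by rewrite add_lfunE scale_lfunE scalerBr opprD addrACA.
rewrite [rplus r _]linearP [star _ _ _ _]starR [z _]linearP.
by rewrite add_lfunE scale_lfunE scalerBr opprD addrACA.
Qed.

HB.instance Definition _ :=
  bilinear_isBilinear.Build K (dual A) (dual A) (dual A) _ _ rsucc
    rsucc_is_bilinear.

HB.instance Definition _ :=
  bilinear_isBilinear.Build K (dual A) (dual A) (dual A) _ _ rprec
    rprec_is_bilinear.

(* The dual side of the bialgebra is A* with the products [rprec] and
   [rsucc], written A_r^* in the literature. *)
Record is_factorizable : Prop := IsFactorizable {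
  fact_bialg : is_D_bialgebra prec succ rprec rsucc;
  fact_Deq : D_equation prec succ r;
  fact_inv : LR_invariant prec succ (tskew r);
  fact_nondeg : bijective (rI r)
}.

End Factorizable.

Section Forms.
Variable A : vectType K.

(* [(rI r)^-1%VF] is the inverse of [rI r] as soon as the latter is bijective. *)
Definition omegaI (r : tensor A A) (x y : A) : K := ((rI r)^-1)%VF x y.

Lemma omegaI_is_bilinear r : bilinear_for *%R *%R (omegaI r).
Proof.
split=> z a x y; rewrite /omegaI; last by rewrite linearP.
by rewrite linearP add_lfunE scale_lfunE.
Qed.

HB.instance Definition _ r :=
  bilinear_isBilinear.Build K A A K _ _ (omegaI r) (omegaI_is_bilinear r).

(* x |-> omega(x, .), the inverse of J_omega *)
Definition omega_flat (omega : {biscalar A}) : 'Hom(A, dual A) :=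
  linfun (fun x => linfun (omega x : A -> K^o)).

Definition J_omega (omega : {biscalar A}) : 'Hom(dual A, A) :=
  ((omega_flat omega)^-1)%VF.

Lemma omega_flatE omega x y : omega_flat omega x y = omega x y.
Proof.
have oL u : linear (omega u : A -> K^o) by move=> a v w; rewrite linearPr.
rewrite /omega_flat linfunE ?linfunE // => a u v; apply/lfunP => w.
by rewrite add_lfunE scale_lfunE !linfunE //= linearPl.
Qed.

Lemma J_omegaK (omega : {biscalar A}) :
    (forall x, (forall y, omega x y = 0) -> x = 0) ->
  cancel (omega_flat omega) (J_omega omega) /\
  cancel (J_omega omega) (omega_flat omega).
Proof.
move=> nd; have inj : lker (omega_flat omega) == 0%VS.
  apply/lker0P => x y /lfunP xy; apply/eqP; rewrite -subr_eq0; apply/eqP.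
  by apply: nd => z; rewrite linearBl /= -!omega_flatE xy subrr.
split; first exact: lker0_lfunK.
move=> xi; apply: limg_lfunVK.
suff -> : limg (omega_flat omega) = fullv by rewrite memvf.
apply/eqP; rewrite eqEdim subvf limg_dim_eq; last first.
  by rewrite capfv; apply/eqP.
by rewrite !dimvf /dim /= muln1.
Qed.

End Forms.
End Dendriform.

(* Main.v *)
(* Put Q = r_- o I^{-1}, so that r_+ o I^{-1} = Q + Id and P = lambda Q, and
   identify A* with A through x |-> omega(x, .) = I^{-1} x.  Then:
   - r_- being the transpose of r_+ is the identity
     omega(Qx, y) + omega(x, Qy) + omega(x, y) = 0;
   - invariance of the skew-symmetric part of r is invariance of omega;
   - the D-equation is the Rota-Baxter identity of weight 1 for Q;
   - the products of A_r^* become Qx.y + x.Qy + x.y, which are dendriform as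
     soon as Q is a Rota-Baxter operator of weight 1;
   - the compatibility conditions become scalar identities in omega and Q.
   Rescaling Q by lambda passes from weight 1 to weight lambda. *)
From HB Require Import structures.
Require Import Defs.
From mathcomp Require Import all_boot all_order all_algebra.
From mathcomp Require Import ring.

Set Implicit Arguments.
Unset Strict Implicit.
Unset Printing Implicit Defensive.

Import GRing.Theory.
Local Open Scope ring_scope.

(** * Descendent products of a Rota-Baxter operator of weight 1 *)

Section Descendent.
Variables (K : fieldType) (A : vectType K) (prec succ : {bilinear A -> A -> A}).

Local Notation "x ≺ y" := (prec x y) (at level 40).
Local Notation "x ≻ y" := (succ x y) (at level 40).
Local Notation "x ∗ y" := (star prec succ x y) (at level 40).

Hypothesis dend : is_dendriform prec succ.

Variable Q : 'End(A).

Definition descendent (m : A -> A -> A) (x y : A) : A :=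
  m (Q x) y + m x (Q y) + m x y.

Local Notation "x ≺' y" := (descendent prec x y) (at level 40).
Local Notation "x ≻' y" := (descendent succ x y) (at level 40).

Lemma star_descendent x y :
  x ≺' y + x ≻' y = descendent (star prec succ) x y.
Proof. by rewrite /star /descendent !addrA [LHS](ACl (1*4*2*5*3*6)). Qed.

Hypotheses (rbp : forall x y, Q x ≺ Q y = Q (x ≺' y))
           (rbs : forall x y, Q x ≻ Q y = Q (x ≻' y)).

Lemma rota_baxter_star x y :
  Q x ∗ Q y = Q (descendent (star prec succ) x y).
Proof. by rewrite -star_descendent linearD /= -rbp -rbs. Qed.

(** [Q] carries the descendent products to the original ones. Each side therefore expands into seven
    terms, one for each way of putting some, but not all, of [x], [y], [z] under [Q], and the axiom
    of [prec] matches them one by one. The other two axioms follow the same pattern. *)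
Lemma descendent_prec x y z :
  (x ≺' y) ≺' z = x ≺' (y ≺' z + y ≻' z).
Proof.
rewrite star_descendent {1 3}/descendent -rbp -rota_baxter_star.
rewrite /descendent !linearDl !linearDr /= !(dend_prec dend) /star.
rewrite !linearDr /= !addrA.
by rewrite [LHS](ACl (1*2*3*4*9*10*5*6*11*12*7*8*13*14)).
Qed.

Lemma descendent_mid x y z : (x ≻' y) ≺' z = x ≻' (y ≺' z).
Proof.
rewrite {1 3}/descendent -rbp -rbs.
rewrite /descendent !linearDl !linearDr /= !(dend_mid dend).
by rewrite !addrA [LHS](ACl (1*2*5*3*6*4*7)).
Qed.

Lemma descendent_succ x y z :
  x ≻' (y ≻' z) = (x ≺' y + x ≻' y) ≻' z.
Proof.
rewrite star_descendent {1 3}/descendent -rbs -rota_baxter_star.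
rewrite /descendent !linearDl !linearDr /= !(dend_succ dend) /star.
rewrite !linearDl /= !addrA.
by rewrite [LHS](ACl (1*2*3*4*7*8*11*12*5*6*9*10*13*14)).
Qed.
End Descendent.

(** * Scalar identities for an invariant skew form and an operator with adjoint -Q - Id *)

Section InvariantForm.
Variables (K : fieldType) (A : vectType K) (prec succ : {bilinear A -> A -> A}).
Variables (omega : {biscalar A}) (Q : 'End(A)).

Local Notation "x ≺ y" := (prec x y) (at level 40).
Local Notation "x ≻ y" := (succ x y) (at level 40).
Local Notation "x ∗ y" := (star prec succ x y) (at level 40).

Hypothesis dend : is_dendriform prec succ.
Hypothesis omega_skew : forall x y, omega x y = - omega y x.
Hypothesis omega_prec : forall x y z, omega (x ≻ y) z = - omega x (y ≺ z).
Hypothesis omega_star : forall x y z, omega (x ≻ y) z = omega y (z ∗ x).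
Hypothesis omega_Q : forall x y,
  omega (Q x) y + omega x (Q y) + omega x y = 0.

Local Notation "x ≺' y" := (descendent Q prec x y) (at level 40).
Local Notation "x ≻' y" := (descendent Q succ x y) (at level 40).

(** This and the next five rules give the ω-adjoints of all multiplication operators. In the names,
    [L] and [R] tell whether the operator taken off the second argument is a left or a right
    multiplication by [x]. *)
Lemma omegaL_succ v x w : omega v (x ≻ w) = omega (v ∗ x) w.
Proof. by rewrite omega_skew omega_star -omega_skew. Qed.

Lemma omegaR_star v x w : omega v (w ∗ x) = omega (x ≻ v) w.
Proof. by rewrite omega_star. Qed.

Lemma omegaL_star v x w : omega v (x ∗ w) = omega (v ≺ x) w.
Proof. by rewrite -omega_star omega_prec -omega_skew. Qed.

Lemma omegaR_prec v x w : omega v (w ≺ x) = omega (x ∗ v) w.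
Proof. by rewrite -[LHS]opprK -omega_prec omega_star -omega_skew. Qed.

Lemma omegaL_prec v x w : omega v (x ≺ w) = - omega (v ≻ x) w.
Proof. by rewrite omega_prec opprK. Qed.

Lemma omegaR_succ v x w : omega v (w ≻ x) = - omega (x ≺ v) w.
Proof. by rewrite omega_skew omega_prec -omega_skew. Qed.

Lemma omega_precl v x w : omega (v ≺ x) w = omega (w ≻ v) x.
Proof. by rewrite -omegaL_star omega_star. Qed.

Lemma omegaQl x y : omega (Q x) y = - omega x (Q y) - omega x y.
Proof. by apply/eqP; rewrite -opprD -addr_eq0 addrA omega_Q. Qed.

Lemma omegaQr x y : omega x (Q y) = - omega (Q x) y - omega x y.
Proof. by rewrite omegaQl; ring. Qed.

Let oDl x y z : omega (x + y) z = omega x z + omega y z.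
Proof. exact: linearDl. Qed.
Let oDr x y z : omega z (x + y) = omega z x + omega z y.
Proof. exact: linearDr. Qed.
Let oBl x y z : omega (x - y) z = omega x z - omega y z.
Proof. exact: linearBl. Qed.
Let oBr x y z : omega z (x - y) = omega z x - omega z y.
Proof. exact: linearBr. Qed.
Let pDl x y z : (x + y) ≺ z = x ≺ z + y ≺ z.
Proof. exact: linearDl. Qed.
Let pDr x y z : z ≺ (x + y) = z ≺ x + z ≺ y.
Proof. exact: linearDr. Qed.
Let pBl x y z : (x - y) ≺ z = x ≺ z - y ≺ z.
Proof. exact: linearBl. Qed.
Let pBr x y z : z ≺ (x - y) = z ≺ x - z ≺ y.
Proof. exact: linearBr. Qed.
Let sDl x y z : (x + y) ≻ z = x ≻ z + y ≻ z.
Proof. exact: linearDl. Qed.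
Let sDr x y z : z ≻ (x + y) = z ≻ x + z ≻ y.
Proof. exact: linearDr. Qed.
Let sBl x y z : (x - y) ≻ z = x ≻ z - y ≻ z.
Proof. exact: linearBl. Qed.
Let sBr x y z : z ≻ (x - y) = z ≻ x - z ≻ y.
Proof. exact: linearBr. Qed.

Let addE := (oBl, oBr, pBl, pBr, sBl, sBr, linearB,
  oDl, oDr, pDl, pDr, sDl, sDr, linearD).

(* The left-hand side is the D-equation paired with the functionals
   omega(x, .), omega(y, .), omega(z, .).  Isolating z gives the Rota-Baxter
   identity of [prec], and isolating y gives the one of [succ]. *)
Lemma D_form_prec x y z :
  omega x (Q y ∗ Q z) - omega z ((Q x + x) ≺ (Q y + y))
    - omega y (Q z ≻ (Q x + x))
  = omega z (Q (x ≺' y) - Q x ≺ Q y).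
Proof.
rewrite omegaL_star omegaQr omegaR_succ omegaQr.
rewrite (omega_skew z _) (omega_skew z _).
rewrite /descendent /star ?addE /=; ring.
Qed.

Lemma D_form_succ x y z :
  omega x (Q y ∗ Q z) - omega z ((Q x + x) ≺ (Q y + y))
    - omega y (Q z ≻ (Q x + x))
  = omega y (Q (z ≻' x) - Q z ≻ Q x).
Proof.
rewrite omegaR_star omegaQr omegaL_prec [Q y + y]addrC oDr omegaQr.
rewrite !(omega_skew y).
rewrite /descendent /star ?addE /=; ring.
Qed.

(** This and the next two identities are the compatibility conditions on the coproducts of A, paired
    with ω(u, ·) ⊗ ω(v, ·). The adjoint rules bring every term to the form ω(..., x); the first
    arguments then agree by [dend_mid] here and by [dend_succ] in the next two. *)
Lemma cocycle_prec u v x y :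
  omega (u ≺' v) (x ∗ y) = omega (u ≺' (v ∗ x)) y + omega ((y ≻ u) ≺' v) x.
Proof.
rewrite omegaR_star /descendent !oDl !(omega_precl _ _ y) omegaQr !omegaL_star.
rewrite !addE !(dend_mid dend) /star ?addE /=; ring.
Qed.

Lemma cocycle_succ u v x y :
  omega (u ≻' v) (x ∗ y) = omega (u ≻' (v ≺ x)) y + omega ((y ∗ u) ≻' v) x.
Proof.
rewrite omegaR_star /descendent !oDl !(omega_star _ _ y) omegaQl.
rewrite !(omega_precl v x).
rewrite !addE !(dend_succ dend) /star ?addE /=; ring.
Qed.

Lemma cocycle_mixed u v x y :
  omega ((u ≺ x) ≺' v) y - omega (u ≺' (x ∗ v)) y
    + (omega ((v ∗ y) ≻' u) x - omega (v ≻' (y ≻ u)) x) = 0.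
Proof.
rewrite /descendent !oDl -(omegaL_star _ (Q v) y) -!(omegaL_star _ v y).
rewrite !(omega_precl _ _ y).
rewrite omegaQl !(omega_precl u x) omegaQr !(omegaR_star _ v x).
rewrite !addE !(dend_succ dend) /star ?addE /=; ring.
Qed.

(** This and the next two identities are the compatibility conditions on the coproducts of A*,
    evaluated at (x, y). Expressions such as y ∗ Qu - Q(y ∗ u) are the transposes of multiplications
    by ω(u, ·) in A_r^*. Here and in the next identity, the proof isolates [y] in the second
    argument of ω. *)
Lemma dual_cocycle_prec u v x y :
  omega (u ≺' v + u ≻' v) (x ≺ y)
  = omega v (x ≺ (y ∗ Q u - Q (y ∗ u)))
    + omega u ((Q v ≻ x - Q (v ≻ x)) ≺ y).
Proof.
rewrite !omegaL_prec oBr omegaQr !omegaR_star star_descendent /descendent.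
rewrite !addE !(dend_succ dend) /star ?addE /=; ring.
Qed.

Lemma dual_cocycle_succ u v x y :
  omega (u ≺' v + u ≻' v) (x ≻ y)
  = omega v (x ≻ (y ≺ Q u - Q (y ≺ u)))
    + omega u ((Q v ∗ x - Q (v ∗ x)) ≻ y).
Proof.
rewrite !omegaL_succ oBr omegaQr !omegaR_prec star_descendent /descendent.
rewrite /star !addE !(dend_prec dend) !(dend_mid dend) !(dend_succ dend).
rewrite /star !addE /=; ring.
Qed.

Lemma dual_cocycle_mixed u v x y :
  omega v ((x ≺ Q u - Q (x ≺ u)) ≺ y) - omega v (x ≺ (Q u ∗ y - Q (u ∗ y)))
    + (omega u ((y ∗ Q v - Q (y ∗ v)) ≻ x) - omega u (y ≻ (Q v ≻ x - Q (v ≻ x))))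
  = 0.
Proof.
rewrite !omegaL_prec !omegaR_succ !oBr !omegaQr !(omegaR_star _ _ y) !omegaL_star.
rewrite !addE !(dend_mid dend) /star ?addE /=; ring.
Qed.
End InvariantForm.

(** * Tensors tested by functionals, and tensors as maps from the dual *)

Section TensorEvaluation.
Variable K : fieldType.
Implicit Types U V W : vectType K.

Lemma eq_tlift U V W (f g : U -> V -> W) t : f =2 g -> tlift f t = tlift g t.
Proof.
by move=> fg; apply: eq_bigr => i _; apply: eq_bigr => j _; rewrite fg.
Qed.

Lemma eq_tliftr U V (f g : U -> V -> K^o) t :
  f =2 g -> tlift f t = tlift g t :> K.
Proof. exact: (@eq_tlift U V K^o). Qed.

Lemma linear_tlift U V W W' (h : W -> W') (f : U -> V -> W) t :
  linear h -> h (tlift f t) = tlift (fun u v => h (f u v)) t.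
Proof.
move=> hL.
pose g : {linear W -> W'} := HB.pack h (GRing.isLinear.Build K W W' _ _ hL).
rewrite -[h]/(g : W -> W') /tlift linear_sum; apply: eq_bigr => i _.
by rewrite linear_sum; apply: eq_bigr => j _; rewrite linearZ_LR.
Qed.

Lemma teval_linear U V (xi : dual U) (eta : dual V) :
  linear (fun t => teval t xi eta : K^o).
Proof. exact: tlift_is_linear. Qed.

Lemma tevalB U V (s t : tensor U V) xi eta :
  teval (s - t) xi eta = teval s xi eta - teval t xi eta.
Proof.
have /= := teval_linear xi eta (-1) t s.
by rewrite !scaleN1r ![- _ + _]addrC.
Qed.

Lemma tevalD U V (s t : tensor U V) xi eta :
  teval (s + t) xi eta = teval s xi eta + teval t xi eta.
Proof. by have /= := teval_linear xi eta 1 s t; rewrite !scale1r. Qed.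

Lemma teval0 U V xi eta : teval (0 : tensor U V) xi eta = 0.
Proof. by rewrite -[0](subrr 0) tevalB subrr. Qed.

Lemma tevalZ U V a (s : tensor U V) xi eta :
  teval (a *: s) xi eta = a * teval s xi eta.
Proof. by have /= := teval_linear xi eta a s 0; rewrite !addr0 teval0 addr0. Qed.

Lemma teval_bcov U V (t : tensor U V) i j : teval t (bcov i) (bcov j) = t i j.
Proof.
rewrite /teval /tlift (bigD1 i) //= (bigD1 j) //= !bcov_bvec !eqxx mulr1.
rewrite [X in _ + X + _]big1 => [|k /negPf kj]; last first.
  by rewrite !bcov_bvec [j == k]eq_sym kj mulr0 scaler0.
rewrite big1 => [|k /negPf ki]; first by rewrite !addr0; exact: mulr1.
by rewrite big1 // => l _; rewrite !bcov_bvec [i == k]eq_sym ki mul0r scaler0.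
Qed.

Lemma tensor_ext U V (s t : tensor U V) :
  (forall xi eta, teval s xi eta = teval t xi eta) -> s = t.
Proof. by move=> st; apply/matrixP => i j; rewrite -!teval_bcov. Qed.

Lemma teval_tlift U V U' V' (f : U -> V -> tensor U' V') t xi eta :
  teval (tlift f t) xi eta
  = tlift (fun u v => teval (f u v) xi eta : K^o) t.
Proof. exact: (linear_tlift f t (teval_linear xi eta)). Qed.

(** The transposed functionals [xi'] and [eta'] are left free, so that they can be supplied directly
    as ω(u, ·) or as evaluations at a vector, with no linearity proof for [f] and [g]. *)
Lemma teval_tmap U V U' V' (f : U -> U') (g : V -> V') t
    (xi : dual U') (eta : dual V') (xi' : dual U) (eta' : dual V) :
    (forall u, xi (f u) = xi' u) -> (forall v, eta (g v) = eta' v) ->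
  teval (tmap f g t) xi eta = teval t xi' eta'.
Proof.
move=> fE gE; rewrite /tmap teval_tlift [RHS]/teval; apply: eq_tliftr => u v.
by rewrite teval_tens fE gE.
Qed.

Lemma teval_tflip U V (t : tensor U V) xi eta :
  teval (tflip t) xi eta = teval t eta xi.
Proof.
rewrite /tflip teval_tlift [RHS]/teval; apply: eq_tliftr => u v.
by rewrite teval_tens mulrC.
Qed.

(** Contraction of the first leg. A triple tensor is tested by contracting once and pairing the
    remaining double tensor. *)
Definition tcontract U V (xi : dual U) (t : tensor U V) : V :=
  tlift (fun u v => (xi u : K) *: v) t.

Lemma tcontract_is_linear U V (xi : dual U) : linear (@tcontract U V xi).
Proof. exact: tlift_is_linear. Qed.

HB.instance Definition _ U V xi := GRing.isLinear.Build K (tensor U V) V _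
  (@tcontract U V xi) (@tcontract_is_linear U V xi).

Lemma tcontract_tens U V (xi : dual U) (u : U) (v : V) :
  tcontract xi (tens u v) = (xi u : K) *: v.
Proof.
apply: tliftE; split=> w a x y.
  have -> : xi (a *: x + y) = a * xi x + xi y :> K by rewrite linearP.
  by rewrite scalerDl -scalerA.
by rewrite /= scalerDr !scalerA [_ * a]mulrC.
Qed.

Lemma tcontract_ext U V (s t : tensor U V) :
  (forall xi, tcontract xi s = tcontract xi t) -> s = t.
Proof.
move=> st; apply: tensor_ext => xi eta.
have E t' : teval t' xi eta = eta (tcontract xi t').
  rewrite /tcontract (@linear_tlift _ _ _ K^o eta) //.
    by apply: eq_tliftr => u v; rewrite linearZ.
  exact: linearP.
by rewrite !E st.
Qed.

Lemma dual_sep V (x y : V) : (forall xi : dual V, xi x = xi y) -> x = y.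
Proof.
move=> xy; rewrite (bvec_sum x) (bvec_sum y).
by apply: eq_bigr => i _; rewrite xy.
Qed.

Lemma bidualP V (Phi : dual (dual V)) : exists x, forall xi, Phi xi = xi x.
Proof.
exists (\sum_i (Phi (bcov i) : K) *: bvec i) => xi.
rewrite {1}(bcov_sum xi) !linear_sum; apply: eq_bigr => i _.
by rewrite !linearZ; exact: mulrC.
Qed.

Lemma rplus_inj V : injective (@rplus K V).
Proof.
by move=> r s rs; apply: tensor_ext => xi eta; rewrite -!rplusP rs.
Qed.

Lemma rplus_surj V (f : 'Hom(dual V, V)) : exists r, rplus r = f.
Proof.
(* The tensor Σ e_i ⊗ f(e^i) is the preimage of f under the canonical isomorphism from V ⊗ V to
   Hom(V*, V). *)
exists (\sum_i tens (bvec i) (f (bcov i))); apply/lfunP => xi.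
rewrite rplusE -[LHS]/(tcontract xi _) linear_sum {2}(bcov_sum xi) linear_sum.
by apply: eq_bigr => i _; rewrite /= tcontract_tens linearZ.
Qed.

Lemma rminus_adj V (r : tensor V V) (xi eta : dual V) :
  xi (rminus r eta) = eta (rplus r xi).
Proof. by rewrite rminusP rplusP. Qed.

End TensorEvaluation.

(** * The D-equation as a scalar identity in r_+ and r_- *)

Section DEquation.
Variables (K : fieldType) (A : vectType K) (prec succ : {bilinear A -> A -> A}).
Variable r : tensor A A.
Implicit Types xi eta zeta : dual A.

Lemma pair_tlift2 (m : A -> A -> A) xi (f g : A -> A -> A) s t :
  bilinear_for *:%R *:%R m ->
  xi (m (tlift f s) (tlift g t))
  = tlift (fun a b => tlift (fun a' b' => xi (m (f a b) (g a' b')) : K^o) t) s.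
Proof.
move=> mB; rewrite (@linear_tlift _ _ _ _ K^o (fun x => xi (m x _))); last first.
  by move=> a u v; rewrite mB.1 linearP.
apply: (@eq_tlift K A A K^o) => a b.
rewrite (@linear_tlift _ _ _ _ K^o (fun x => xi (m _ x))) // => c u v.
by rewrite mB.2 linearP.
Qed.

Lemma bilinear_scale (m : A -> A -> A) (mB : bilinear_for *:%R *:%R m) a b x y :
  m (a *: x) (b *: y) = a *: (b *: m x y).
Proof.
by rewrite (GRing.scalable_linear (mB.1 _)) (GRing.scalable_linear (mB.2 _)).
Qed.

Lemma star_bilinear : bilinear_for *:%R *:%R (star prec succ).
Proof.
by split=> z a x y; rewrite /star (linearPl, linearPr) (linearPl, linearPr);
  rewrite /= scalerDr addrACA.
Qed.

Lemma bilinear_forP (m : {bilinear A -> A -> A}) : bilinear_for *:%R *:%R m.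
Proof. by split=> z a x y; rewrite (linearPl, linearPr). Qed.

(** The pairing with ξ ⊗ η ⊗ ζ. *)
Let eval3 xi eta zeta (t : tensor A (tensor A A)) :=
  teval (tcontract xi t) eta zeta.

Let eval3_tlift2 xi eta zeta (f g h : A -> A -> A -> A -> A) :
  eval3 xi eta zeta (tlift (fun a b => tlift (fun a' b' =>
    tens (f a b a' b') (tens (g a b a' b') (h a b a' b'))) r) r)
  = tlift (fun a b => tlift (fun a' b' => xi (f a b a' b') *
      (eta (g a b a' b') * zeta (h a b a' b')) : K^o) r) r.
Proof.
rewrite /eval3 (linear_tlift _ _ (@tcontract_is_linear _ _ _ xi)) teval_tlift.
apply: (@eq_tlift K A A K^o) => a b.
rewrite (linear_tlift _ _ (@tcontract_is_linear _ _ _ xi)) teval_tlift.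
by apply: (@eq_tlift K A A K^o) => a' b'; rewrite tcontract_tens tevalZ teval_tens.
Qed.

(** In each term two functionals hit a bare leg of one copy of r, which turns that copy into r_+ or
    r_- of the functional; the third functional hits the product of the two remaining legs. *)
Lemma D_equationP : D_equation prec succ r <->
  forall xi eta zeta,
    xi (star prec succ (rminus r eta) (rminus r zeta))
      - zeta (prec (rplus r xi) (rplus r eta))
      - eta (succ (rminus r zeta) (rplus r xi)) = 0.
Proof.
have E xi eta zeta : eval3 xi eta zeta
    (D_12_13 prec succ r - D_13_23 prec r - D_23_12 succ r)
  = xi (star prec succ (rminus r eta) (rminus r zeta))
      - zeta (prec (rplus r xi) (rplus r eta))
      - eta (succ (rminus r zeta) (rplus r xi)).
  have scalE (m : A -> A -> A) (theta : dual A) a b x y :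
      bilinear_for *:%R *:%R m ->
      theta (m (a *: x) (b *: y)) = a * (b * theta (m x y)) :> K.
    by move=> mB; rewrite (bilinear_scale mB) linearZ /= linearZ.
  rewrite /eval3 !linearB /= !tevalB; congr (_ - _ - _).
  - rewrite -/(eval3 _ _ _ _) eval3_tlift2 !rminusE.
    rewrite (pair_tlift2 _ _ _ _ _ star_bilinear).
    apply: (@eq_tlift K A A K^o) => a b; apply: (@eq_tlift K A A K^o) => a' b'.
    rewrite (scalE _ _ _ _ _ _ star_bilinear).
    ring.
  - rewrite -/(eval3 _ _ _ _) eval3_tlift2 !rplusE.
    rewrite (pair_tlift2 _ _ _ _ _ (bilinear_forP prec)).
    apply: (@eq_tlift K A A K^o) => a b; apply: (@eq_tlift K A A K^o) => a' b'.
    by rewrite (scalE _ _ _ _ _ _ (bilinear_forP prec)).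
  - rewrite -/(eval3 _ _ _ _) eval3_tlift2 rplusE rminusE.
    rewrite (pair_tlift2 _ _ _ _ _ (bilinear_forP succ)).
    apply: (@eq_tlift K A A K^o) => a b; apply: (@eq_tlift K A A K^o) => a' b'.
    rewrite (scalE _ _ _ _ _ _ (bilinear_forP succ)).
    ring.
split=> [D xi eta zeta | D].
  by rewrite -E D /eval3 linear0 teval0.
apply: tcontract_ext => xi; apply: tensor_ext => eta zeta.
by rewrite -[LHS]/(eval3 _ _ _ _) E D linear0 teval0.
Qed.

End DEquation.

(** * Reflexivity, and coproducts on the dual evaluated at vectors *)

Section Bidual.
Variables (K : fieldType) (V : vectType K).

Definition bidual_ev (x : V) : dual (dual V) :=
  linfun (fun xi : dual V => xi x : K^o).

Lemma bidual_evE x xi : bidual_ev x xi = xi x.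
Proof.
apply: (@linfunE _ (dual V) K^o) => a u v.
by rewrite add_lfunE scale_lfunE.
Qed.

Lemma dual_tensor_ext (s t : tensor (dual V) (dual V)) :
  (forall x y, teval s (bidual_ev x) (bidual_ev y)
     = teval t (bidual_ev x) (bidual_ev y)) -> s = t.
Proof.
move=> st; apply: tensor_ext => X Y.
have [[x Xx] [y Yy]] := (bidualP X, bidualP Y).
have -> : X = bidual_ev x by apply/lfunP => z; rewrite bidual_evE.
by have -> : Y = bidual_ev y by apply/lfunP => z; rewrite bidual_evE.
Qed.

Lemma teval_cop (m : V -> V -> V) (mB : bilinear_for *:%R *:%R m) xi x y :
  teval (cop m xi) (bidual_ev x) (bidual_ev y) = xi (m x y).
Proof.
rewrite -(copP mB); apply: eq_tliftr => u v.
by rewrite !bidual_evE.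
Qed.

End Bidual.

(** Both sides of the Rota-Baxter identity are homogeneous of degree 2 when the operator and the
    weight are scaled together. *)
Lemma rota_baxter_scale (K : fieldType) (A : vectType K)
    (m : {bilinear A -> A -> A}) (a c : K) (P : 'End(A)) :
  is_rota_baxter a m P -> is_rota_baxter (c * a) m (c *: P).
Proof.
move=> rb x y; rewrite !scale_lfunE !linearZl_LR !linearZr_LR /= rb.
by rewrite -scalerA -!scalerDr [P (c *: _)]linearZ.
Qed.

(** * Invariance of the skew-symmetric part of r in terms of I *)

Section Invariance.
Variables (K : fieldType) (A : vectType K) (prec succ : {bilinear A -> A -> A}).
Variable r : tensor A A.

Lemma rIE xi : rI r xi = rplus r xi - rminus r xi.
Proof. by rewrite add_lfunE opp_lfunE. Qed.

(** Since r_- is the transpose of r_+, transposing I = r_+ - r_- changes its sign. *)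
Lemma rI_skew (xi eta : dual A) : xi (rI r eta) = - eta (rI r xi).
Proof.
by rewrite !rIE !linearB /= !rminus_adj opprK addrC.
Qed.

Lemma teval_tskew (xi eta : dual A) :
  teval (tskew r) xi eta = 2%:R^-1 * eta (rI r xi).
Proof.
rewrite tevalZ tevalB teval_tflip; congr (_ * _).
by rewrite rIE linearB /= rminus_adj !rplusP.
Qed.

Lemma LR_invariant_tskewP : 2%:R != 0 :> K ->
  LR_invariant prec succ (tskew r) <->
  forall x (xi eta : dual A),
    eta (star prec succ x (rI r xi)) + xi (prec (rI r eta) x) = 0 /\
    eta (succ x (rI r xi)) + xi (star prec succ (rI r eta) x) = 0.
Proof.
move=> two0.
have evR (f : A -> A) (fL : linear f) xi eta :
    teval (tmap id f (tskew r)) xi eta = 2%:R^-1 * eta (f (rI r xi)).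
  rewrite (teval_tmap _ (xi' := xi) (eta' := Ftr f eta)) // => [|v].
    by rewrite teval_tskew FtrE.
  by rewrite FtrE.
(* Skewness of I lets an operator on the first leg act on [rI r eta], at the cost of a sign; this
   sign turns the differences in the invariance conditions into sums. *)
have evL (f : A -> A) (fL : linear f) xi eta :
    teval (tmap f id (tskew r)) xi eta = - (2%:R^-1 * xi (f (rI r eta))).
  rewrite (teval_tmap _ (xi' := Ftr f xi) (eta' := eta)) // => [|v].
    by rewrite teval_tskew rI_skew FtrE // mulrN.
  by rewrite FtrE.
have tevalN (t : tensor A A) xi eta : teval (- t) xi eta = - teval t xi eta.
  by rewrite -[- t]scaleN1r tevalZ mulN1r.
have flipN : tflip (tskew r) = - tskew r.
  apply: tensor_ext => xi eta.
  by rewrite teval_tflip tevalN !teval_tskew rI_skew mulrN.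
have tmapN (f g : A -> A) : tmap f g (- tskew r) = - tmap f g (tskew r).
  by rewrite /tmap linearN.
have LopL (m : A -> A -> A) x : bilinear_for *:%R *:%R m -> linear (Lop m x).
  by move=> mB; exact: mB.2.
have RopL (m : A -> A -> A) x : bilinear_for *:%R *:%R m -> linear (Rop m x).
  by move=> mB; exact: mB.1.
have sB := star_bilinear prec succ.
have pB := bilinear_forP prec.
have cB := bilinear_forP succ.
rewrite /LR_invariant flipN; split=> [inv x xi eta | inv x].
  have [/(congr1 (fun t => teval t xi eta)) i1
        /(congr1 (fun t => teval t xi eta)) i2] := inv x.
  move: i1 i2; rewrite !tmapN !tevalB !tevalN teval0.
  rewrite evR ?evL ?evR; try by [exact: LopL | exact: RopL].
  rewrite /Lop /Rop => i1 i2.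
  (* The factor 1/2 in the skew-symmetric part is cancelled because the characteristic is not 2. *)
  have half0 (a : K) : 2%:R^-1 * a = 0 -> a = 0.
    by move=> /eqP; rewrite mulf_eq0 invr_eq0 (negPf two0) => /eqP.
  split; apply: half0; first by rewrite mulrDr -[RHS]i1; ring.
  by rewrite mulrDr -[RHS]oppr0 -[in RHS]i2; ring.
split; apply: tensor_ext => xi eta; have [i1 i2] := inv x xi eta;
  rewrite teval0 tevalB ?tmapN ?tevalN;
  (rewrite evR; last by [exact: LopL]); (rewrite evL; last by [exact: RopL]).
- by rewrite opprK -mulrDr i1 mulr0.
- have /= := congr1 (fun a => - (2%:R^-1 * a)) i2.
  by rewrite mulr0 oppr0 => <-; rewrite /Lop /Rop; ring.
Qed.

End Invariance.

(** * Transport of A_r^* to A along ω *)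

Section Factorization.
Variables (K : fieldType) (A : vectType K) (prec succ : {bilinear A -> A -> A}).
Variables (omega : {biscalar A}) (Q : 'End(A)) (r : tensor A A).

Local Notation "x ≺ y" := (prec x y) (at level 40).
Local Notation "x ≻ y" := (succ x y) (at level 40).
Local Notation "x ∗ y" := (star prec succ x y) (at level 40).
Local Notation "x ≺' y" := (descendent Q prec x y) (at level 40).
Local Notation "x ≻' y" := (descendent Q succ x y) (at level 40).
Local Notation flat := (omega_flat omega).
Local Notation rprec := (rprec prec succ r).
Local Notation rsucc := (rsucc prec succ r).

Hypothesis dend : is_dendriform prec succ.
Hypothesis omega_skew : forall x y, omega x y = - omega y x.
Hypothesis omega_prec : forall x y z, omega (x ≻ y) z = - omega x (y ≺ z).
Hypothesis omega_star : forall x y z, omega (x ≻ y) z = omega y (z ∗ x).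
Hypothesis omega_nondeg : forall x, (forall y, omega x y = 0) -> x = 0.
Hypothesis omega_Q : forall x y,
  omega (Q x) y + omega x (Q y) + omega x y = 0.
Hypothesis rplus_flat : forall u, rplus r (flat u) = Q u + u.
Hypothesis rminus_flat : forall u, rminus r (flat u) = Q u.

(** Nondegeneracy makes every functional some ω(u, ·), so each identity on A* can be checked on
    elements of A. *)
Let flat_surj xi : exists u, xi = flat u.
Proof.
by have [_ JK] := J_omegaK omega_nondeg; exists (J_omega omega xi); rewrite JK.
Qed.

Lemma omega_nondegr x y : (forall z, omega z (x - y) = 0) -> x = y.
Proof.
move=> xy; apply/eqP; rewrite -subr_eq0; apply/eqP/omega_nondeg => z.
by rewrite omega_skew xy oppr0.
Qed.

Lemma rprec_flat u v : rprec (flat u) (flat v) = flat (u ≺' v).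
Proof.
apply/lfunP => y.
rewrite rprecE !rplus_flat !rminus_flat !omega_flatE /descendent.
rewrite (omegaL_star omega_skew omega_prec omega_star).
rewrite (omegaR_succ omega_skew omega_prec).
rewrite !linearDl !linearDr linearDl /=; ring.
Qed.

Lemma rsucc_flat u v : rsucc (flat u) (flat v) = flat (u ≻' v).
Proof.
apply/lfunP => y.
rewrite rsuccE !rplus_flat !rminus_flat !omega_flatE /descendent.
rewrite (omegaR_star omega_star) (omegaL_prec omega_prec).
rewrite !linearDl /=; ring.
Qed.

Lemma D_equation_flatP : D_equation prec succ r <->
  forall x y z, omega x (Q y ∗ Q z) - omega z ((Q x + x) ≺ (Q y + y))
    - omega y (Q z ≻ (Q x + x)) = 0.
Proof.
rewrite D_equationP; split=> D => [x y z | xi eta zeta].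
  by rewrite -(D (flat x) (flat y) (flat z)) !rplus_flat !rminus_flat !omega_flatE.
have [[x ->] [y ->] [z ->]] := And3 (flat_surj xi) (flat_surj eta) (flat_surj zeta).
by rewrite !rplus_flat !rminus_flat !omega_flatE.
Qed.

(** The same trilinear form is rewritten in two ways, with a different free argument isolated each
    time; nondegeneracy then gives one Rota-Baxter identity for each product. *)
Lemma D_equation_rota_baxter : D_equation prec succ r ->
  (forall x y, Q x ≺ Q y = Q (x ≺' y)) /\ (forall x y, Q x ≻ Q y = Q (x ≻' y)).
Proof.
move=> /D_equation_flatP D; split=> x y; apply/esym/omega_nondegr => z.
  by rewrite -(D_form_prec omega_skew omega_prec omega_star omega_Q).
by rewrite -(D_form_succ omega_skew omega_prec omega_star omega_Q).
Qed.

Lemma rota_baxter_D_equation :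
  (forall x y, Q x ≺ Q y = Q (x ≺' y)) -> D_equation prec succ r.
Proof.
move=> rb; apply/D_equation_flatP => x y z.
rewrite (D_form_prec omega_skew omega_prec omega_star omega_Q) rb subrr.
exact: linear0r.
Qed.

Lemma rdual_dendriform :
    (forall x y, Q x ≺ Q y = Q (x ≺' y)) ->
    (forall x y, Q x ≻ Q y = Q (x ≻' y)) ->
  is_dendriform rprec rsucc.
Proof.
move=> rbp rbs; split=> xi eta zeta;
  have [[x ->] [y ->] [z ->]] :=
    And3 (flat_surj xi) (flat_surj eta) (flat_surj zeta);
  rewrite /star /= ?(rprec_flat, rsucc_flat) -?linearD ?(rprec_flat, rsucc_flat).
- by rewrite (descendent_prec dend rbp rbs).
- by rewrite (descendent_mid dend rbp rbs).
- by rewrite (descendent_succ dend rbp rbs).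
Qed.

Lemma rI_flat u : rI r (flat u) = u.
Proof. by rewrite rIE rplus_flat rminus_flat addrC addKr. Qed.

Lemma rI_bijective : bijective (rI r).
Proof.
exists flat => [xi | u]; last exact: rI_flat.
by have [u ->] := flat_surj xi; rewrite rI_flat.
Qed.

Lemma tskew_invariant : 2%:R != 0 :> K -> LR_invariant prec succ (tskew r).
Proof.
move=> two0; apply/(LR_invariant_tskewP _ _ _ two0) => x xi eta.
have [[u ->] [v ->]] := (flat_surj xi, flat_surj eta).
rewrite !rI_flat !omega_flatE; split.
  by rewrite (omegaL_star omega_skew omega_prec omega_star) omega_skew addNr.
by rewrite (omegaL_succ omega_skew omega_star) omega_skew addNr.
Qed.

Let pairL_succ := omegaL_succ omega_skew omega_star.
Let pairR_star := omegaR_star omega_star.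
Let pairL_star := omegaL_star omega_skew omega_prec omega_star.
Let pairR_prec := omegaR_prec omega_skew omega_prec omega_star.

Lemma cop_rprec_flat x u v :
  teval (cop_dual rprec x) (flat u) (flat v) = omega (u ≺' v) x.
Proof.
by rewrite cop_dualP ?rprec_flat ?omega_flatE //; exact: rprec_is_bilinear.
Qed.

Lemma cop_rsucc_flat x u v :
  teval (cop_dual rsucc x) (flat u) (flat v) = omega (u ≻' v) x.
Proof.
by rewrite cop_dualP ?rsucc_flat ?omega_flatE //; exact: rsucc_is_bilinear.
Qed.

Lemma rdual_compatible :
  D_compatible prec succ (cop_dual rprec) (cop_dual rsucc).
Proof.
have idE w a : flat w (id a) = flat w a by [].
(* The four adjoint rules supply the transposes that [teval_tmap] asks for; each condition then
   becomes one of the cocycle identities. *)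
have Ls x v a : flat v (Lop succ x a) = flat (v ∗ x) a.
  by rewrite !omega_flatE /Lop pairL_succ.
have Rs x v a : flat v (Rop (star prec succ) x a) = flat (x ≻ v) a.
  by rewrite !omega_flatE /Rop pairR_star.
have Lt x v a : flat v (Lop (star prec succ) x a) = flat (v ≺ x) a.
  by rewrite !omega_flatE /Lop pairL_star.
have Rp x v a : flat v (Rop prec x a) = flat (x ∗ v) a.
  by rewrite !omega_flatE /Rop pairR_prec.
split=> x y; apply: tensor_ext => xi eta;
  have [[u ->] [v ->]] := (flat_surj xi, flat_surj eta).
- rewrite tevalD (teval_tmap _ (idE u) (Ls x v)) (teval_tmap _ (Rs y u) (idE v)).
  by rewrite !cop_rprec_flat (cocycle_prec dend omega_skew omega_prec omega_star).
- rewrite tevalD (teval_tmap _ (idE u) (Lt x v)) (teval_tmap _ (Rp y u) (idE v)).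
  by rewrite !cop_rsucc_flat (cocycle_succ dend omega_skew omega_prec omega_star).
- rewrite tevalD teval_tflip !tevalB teval0.
  rewrite (teval_tmap _ (Lt x u) (idE v)) (teval_tmap _ (idE u) (Rp x v)).
  (* The flip has exchanged the two functionals, so here [v] belongs to the first leg and [u] to the
     second. *)
  rewrite (teval_tmap _ (Ls y v) (idE u)) (teval_tmap _ (idE v) (Rs y u)).
  rewrite !cop_rprec_flat !cop_rsucc_flat.
  by rewrite (cocycle_mixed dend omega_skew omega_prec omega_star omega_Q).
Qed.

Lemma rdual_compatible_dual : D_compatible rprec rsucc (cop prec) (cop succ).
Proof.
have idE (x : A) a : bidual_ev x (id a) = bidual_ev x a by [].
have rstar_flat u v : star rprec rsucc (flat u) (flat v) = flat (u ≺' v + u ≻' v).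
  by rewrite /star /= rprec_flat rsucc_flat [RHS]linearD.
(* The four operators on A* are transposed to operators on A; the terms in Q(...) come from moving Q
   across ω through its adjoint -Q - Id. *)
have Ls u y xi : bidual_ev y (Lop rsucc (flat u) xi)
    = bidual_ev (y ∗ Q u - Q (y ∗ u)) xi.
  have [v ->] := flat_surj xi; rewrite /Lop rsucc_flat !bidual_evE !omega_flatE.
  rewrite linearBr /= (omegaQr omega_Q) !pairR_star /descendent !linearDl /=; ring.
have Rt u y xi : bidual_ev y (Rop (star rprec rsucc) (flat u) xi)
    = bidual_ev (Q u ≻ y - Q (u ≻ y)) xi.
  have [v ->] := flat_surj xi; rewrite /Rop rstar_flat !bidual_evE !omega_flatE.
  rewrite star_descendent linearBr /= (omegaQr omega_Q) !pairL_succ /descendent.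
  rewrite !linearDl /=; ring.
have Lt u y xi : bidual_ev y (Lop (star rprec rsucc) (flat u) xi)
    = bidual_ev (y ≺ Q u - Q (y ≺ u)) xi.
  have [v ->] := flat_surj xi; rewrite /Lop rstar_flat !bidual_evE !omega_flatE.
  rewrite star_descendent linearBr /= (omegaQr omega_Q) !pairR_prec /descendent.
  rewrite !linearDl /=; ring.
have Rp u y xi : bidual_ev y (Rop rprec (flat u) xi)
    = bidual_ev (Q u ∗ y - Q (u ∗ y)) xi.
  have [v ->] := flat_surj xi; rewrite /Rop rprec_flat !bidual_evE !omega_flatE.
  rewrite linearBr /= (omegaQr omega_Q) !pairL_star /descendent !linearDl /=; ring.
have copE (m : {bilinear A -> A -> A}) w x y :
    teval (cop m (flat w)) (bidual_ev x) (bidual_ev y) = omega w (m x y).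
  by rewrite (teval_cop (bilinear_forP m)) omega_flatE.
split=> xi eta; apply: dual_tensor_ext => x y;
  have [[u ->] [v ->]] := (flat_surj xi, flat_surj eta).
- rewrite tevalD (teval_tmap _ (idE x) (Ls u y)) (teval_tmap _ (Rt v x) (idE y)).
  rewrite rstar_flat !copE.
  exact: dual_cocycle_prec dend omega_prec omega_star omega_Q u v x y.
- rewrite tevalD (teval_tmap _ (idE x) (Lt u y)) (teval_tmap _ (Rp v x) (idE y)).
  rewrite rstar_flat !copE.
  exact: dual_cocycle_succ dend omega_skew omega_prec omega_star omega_Q u v x y.
- rewrite tevalD teval_tflip !tevalB teval0.
  rewrite (teval_tmap _ (Lt u x) (idE y)) (teval_tmap _ (idE x) (Rp u y)).
  rewrite (teval_tmap _ (Ls v y) (idE x)) (teval_tmap _ (idE y) (Rt v x)).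
  rewrite !copE.
  exact: dual_cocycle_mixed dend omega_skew omega_prec omega_star omega_Q u v x y.
Qed.

Lemma rota_baxter_factorizable : 2%:R != 0 :> K ->
    (forall x y, Q x ≺ Q y = Q (x ≺' y)) ->
    (forall x y, Q x ≻ Q y = Q (x ≻' y)) ->
  is_factorizable prec succ r.
Proof.
move=> two0 rbp rbs; split.
- split=> //; [exact: rdual_dendriform | exact: rdual_compatible |
    exact: rdual_compatible_dual].
- exact: rota_baxter_D_equation.
- exact: tskew_invariant.
- exact: rI_bijective.
Qed.
End Factorization.

(** * Passage between weight 1 and weight λ, and the two directions of the correspondence *)

Lemma rota_baxter_descendentP (K : fieldType) (A : vectType K)
    (m : {bilinear A -> A -> A}) (Q : 'End(A)) :
  is_rota_baxter 1 m Q <-> forall x y, m (Q x) (Q y) = Q (descendent Q m x y).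
Proof. by split=> rb x y; rewrite rb /descendent scale1r. Qed.

Theorem theorem4p8 (K : fieldType) (charK : 2%N \notin [pchar K])
    (A : vectType K) (prec succ : {bilinear A -> A -> A}) (lambda : K) :
  (forall r : tensor A A,
     is_factorizable prec succ r ->
     is_quadratic_RB prec succ lambda
       (lambda *: (rminus r \o (rI r)^-1)%VF) (omegaI r))
  /\
  (lambda != 0 ->
   forall (P : 'End(A)) (omega : {biscalar A}),
     is_quadratic_RB prec succ lambda P omega ->
     let rp : 'Hom(dual A, A) :=
       lambda^-1 *: ((P + lambda *: \1) \o J_omega omega)%VF in
     (exists! r : tensor A A, rplus r = rp) /\
     (forall r : tensor A A, rplus r = rp ->
        D_equation prec succ r /\ is_factorizable prec succ r)).
Proof.
have two0 : 2%:R != 0 :> K by move: charK; rewrite inE /=.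
split=> [r [[dend _ _ _] Deq inv bij] | lambda0 P omega qRB rp].
- set Q := (rminus r \o (rI r)^-1)%VF.
  (* The inverse of a linear map is a right inverse only on the image, which is the whole space by
     bijectivity. *)
  have IVK x : rI r ((rI r)^-1%VF x) = x.
    by have [f _ fK] := bij; apply: limg_lfunVK; rewrite -(fK x) memv_img ?memvf.
  have VIK xi : (rI r)^-1%VF (rI r xi) = xi.
    by apply: (bij_inj bij); rewrite IVK.
  (* For this form, x ↦ ω(x, ·) is I^{-1} itself, so r_- and r_+ become Q and Q + Id. *)
  have flatE x : omega_flat (omegaI r) x = (rI r)^-1%VF x.
    by apply/lfunP => y; rewrite omega_flatE.
  have minus_flat x : rminus r (omega_flat (omegaI r) x) = Q x.
    by rewrite flatE comp_lfunE.
  have plus_flat x : rplus r (omega_flat (omegaI r) x) = Q x + x.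
    by rewrite -minus_flat -{3}[x]IVK -flatE rIE addrC subrK.
  have skew x y : omegaI r x y = - omegaI r y x.
    by rewrite /omegaI -{1}[y]IVK rI_skew IVK.
  have nondeg x : (forall y, omegaI r x y = 0) -> x = 0.
    move=> x0; rewrite -[x]IVK; suff -> : (rI r)^-1%VF x = 0 by rewrite linear0.
    by apply/lfunP => y; rewrite zero_lfunE; exact: x0.
  have /(LR_invariant_tskewP _ _ _ two0) inv' := inv.
  (* The second invariance equation, taken at I^{-1}y and I^{-1}z, is this identity up to skewness;
     the first one, combined with it, gives [oP]. *)
  have oS x y z : omegaI r (succ x y) z = omegaI r y (star prec succ z x).
    have [_] := inv' x ((rI r)^-1%VF y) ((rI r)^-1%VF z).
    rewrite !IVK => /eqP; rewrite addr_eq0 skew => /eqP e.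
    by rewrite /omegaI e opprK.
  have oP x y z : omegaI r (succ x y) z = - omegaI r x (prec y z).
    have [e _] := inv' z ((rI r)^-1%VF x) ((rI r)^-1%VF y).
    rewrite oS; apply/eqP; rewrite -addr_eq0; apply/eqP.
    by rewrite -[RHS]e !IVK.
  have oQ x y : omegaI r (Q x) y + omegaI r x (Q y) + omegaI r x y = 0.
    (* This is the transposition of r_- into r_+, read through I^{-1}. *)
    have -> : omegaI r x (Q y) = omegaI r y (Q x + x).
      by rewrite -!omega_flatE -minus_flat rminus_adj plus_flat.
    by rewrite (skew y) linearDl /= opprD; ring.
  have [rbp rbs] :=
    D_equation_rota_baxter skew oP oS nondeg oQ plus_flat minus_flat Deq.
  (* Multiplying by λ needs no inverse, so λ = 0 is covered, with P = 0. *)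
  have rb1 (m : {bilinear A -> A -> A}) :
      is_rota_baxter 1 m Q -> is_rota_baxter lambda m (lambda *: Q).
    by rewrite -{1}[lambda]mulr1; exact: rota_baxter_scale.
  split=> //.
  + exact/rb1/rota_baxter_descendentP.
  + exact/rb1/rota_baxter_descendentP.
  + move=> x y; rewrite !scale_lfunE linearZl_LR linearZr_LR /= -!mulrDr oQ.
    by rewrite mulr0.
have [dend rbP rbS skew nondeg oP oS omP] := qRB.
(* Dividing by λ normalizes the weight to 1 and turns the prescribed r_+ into (Q + Id) ∘ J. *)
set Q := lambda^-1 *: P.
have [flatK JK] := J_omegaK nondeg.
have oQ x y : omega (Q x) y + omega x (Q y) + omega x y = 0.
  rewrite !scale_lfunE linearZl_LR linearZr_LR /=.
  by rewrite -[omega x y](mulKf lambda0) -!mulrDr omP mulr0.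
have rb1 (m : {bilinear A -> A -> A}) :
    is_rota_baxter lambda m P -> is_rota_baxter 1 m Q.
  by rewrite -(mulVf lambda0); exact: rota_baxter_scale.
split; first have [r rE] := rplus_surj rp.
  exists r; split=> // r' r'E.
  by apply: rplus_inj; rewrite rE r'E.
move=> r rE.
have plus_flat x : rplus r (omega_flat omega x) = Q x + x.
  rewrite rE scale_lfunE comp_lfunE flatK add_lfunE scale_lfunE id_lfunE.
  by rewrite scalerDr scalerA mulVf // scale1r scale_lfunE.
(* Only r_+ is prescribed; r_- is recovered as its transpose, and the adjoint of Q + Id for ω is
   -Q. *)
have minus_flat x : rminus r (omega_flat omega x) = Q x.
  apply: dual_sep => xi; rewrite -[xi]JK rminus_adj plus_flat !omega_flatE.
  rewrite linearDr /= [omega x _]skew [omega x _]skew.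
  apply/eqP; rewrite -subr_eq0 -oppr_eq0 -(oQ (J_omega omega xi) x); apply/eqP.
  ring.
have fact : is_factorizable prec succ r.
  apply: (rota_baxter_factorizable dend skew oP oS nondeg oQ plus_flat
    minus_flat) => //.
    by apply/rota_baxter_descendentP/rb1.
  by apply/rota_baxter_descendentP/rb1.
by split=> //; case: fact.
Qed.
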